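(* For every $r\in(0,\frac12]$ it holds that $A(r)=\frac14$.
   Context: $\mathbb{S}^1\subset\mathbb{R}^2$ is the unit circle centered at the origin, and $\mathcal{M}(\mathbb{S}^1)$ is the set of Borel probability measures on $\mathbb{S}^1$. For $x,y\in\mathbb{S}^1$ with $x\ne y$, $\operatorname{aff}(x,y)$ is the line through $x$ and $y$; $\operatorname{aff}(x,x)$ is the tangent line to $\mathbb{S}^1$ at $x$. Define $f:(\mathbb{S}^1)^4\to[0,\infty]$ by: $f(x_1,x_2,x_3,x_4)=\|x_0\|_2$ if $\operatorname{aff}(x_1,x_2)\cap\operatorname{aff}(x_3,x_4)=\{x_0\}$ is a single point; $f(x_1,x_2,x_3,x_4)=$ the Euclidean distance from the line $\operatorname{aff}(x_1,x_2)$ to the origin if $\operatorname{aff}(x_1,x_2)=\operatorname{aff}(x_3,x_4)$; $f(x_1,x_2,x_3,x_4)=\infty$ if $\operatorname{aff}(x_1,x_2)\cap\operatorname{aff}(x_3,x_4)=\emptyset$. For $\mu\in\mathcal{M}(\mathbb{S}^1)$, $\mathbb{P}_\mu(\ell<r):=\mu^{\otimes 4}(\{f<r\})$, i.e. $\ell=f(X_1,X_2,X_3,X_4)$ with $X_i$ independent and $\mu$-distributed. For $0\le r\le1$, $A(r)=\sup_{\mu\in\mathcal{M}(\mathbb{S}^1)}\mathbb{P}_\mu(\ell<r)$. *)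

(* Defs.v *)
From HB Require Import structures.
From mathcomp Require Import all_boot all_order all_algebra.
From mathcomp Require Import all_classical all_reals all_analysis.

Set Implicit Arguments.
Unset Strict Implicit.
Unset Printing Implicit Defensive.

Import Order.TTheory GRing.Theory Num.Theory.
Import numFieldNormedType.Exports.

Local Open Scope classical_set_scope.
Local Open Scope ring_scope.

(* The library norm of [R * R] is the sup norm, hence this definition; both
   norms induce the (product) topology that [R * R] carries. *)
Definition euclid_norm (R : realType) (z : R * R) : R :=
  Num.sqrt (z.1 ^+ 2 + z.2 ^+ 2).

Definition unit_circle (R : realType) : set (R * R) :=
  [set z | euclid_norm z = 1].

(* The circle as a type, with the subspace topology inherited from [R * R].
   The base point is only there because the library's measurable types are
   required to be pointed. *)
Definition circle (R : realType) : Type := set_type (@unit_circle R).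

Lemma unit_circle_point (R : realType) :
  ((1, 0) : R * R) \in @unit_circle R.
Proof.
by apply/mem_set; rewrite /unit_circle /euclid_norm /= expr1n expr0n addr0 sqrtr1.
Qed.

HB.instance Definition _ (R : realType) :=
  Topological.on (circle R).
HB.instance Definition _ (R : realType) :=
  isPointed.Build (circle R) (SigSub (unit_circle_point R)).

Definition borel_circle (R : realType) :=
  g_sigma_algebraType (@open (circle R)).

Definition circle_pt (R : realType) (x : borel_circle R) : R * R :=
  @set_val _ (@unit_circle R) x.

(* For [x] on the circle, the points [z] with [z - x] orthogonal to [x] form
   the tangent line at [x]. *)
Definition aff (R : realType) (x y : borel_circle R) : set (R * R) :=
  let p := circle_pt x in
  let q := circle_pt y in
  if x == y then [set z | (z.1 - p.1) * p.1 + (z.2 - p.2) * p.2 = 0]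
  else [set p + t *: (q - p) | t in [set: R]].

Definition dist_origin (R : realType) (L : set (R * R)) : R :=
  inf [set euclid_norm z | z in L].

Definition meet_dist (R : realType) (x1 x2 x3 x4 : borel_circle R) : \bar R :=
  let L := aff x1 x2 in
  let M := aff x3 x4 in
  if `[< exists x0, L `&` M = [set x0] >]
  then (euclid_norm (get (L `&` M)))%:E
  else if `[< L = M >] then (dist_origin L)%:E
  else +oo%E.

Definition prob_lt (R : realType) (mu : probability (borel_circle R) R) (r : R)
    : \bar R :=
  (mu \x mu \x mu \x mu)%E
    [set x : borel_circle R * borel_circle R * borel_circle R * borel_circle R
       | (meet_dist x.1.1.1 x.1.1.2 x.1.2 x.2 < r%:E)%E].

Definition sup_prob (R : realType) (r : R) : \bar R :=
  ereal_sup [set prob_lt mu r | mu in [set: probability (borel_circle R) R]].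

(* Main.v *)
(* If a chord meets the open disc of radius 1/2, its endpoints have inner product
   less than -1/2. The graph of such pairs on the circle is triangle-free, since
   |x + y + z|^2 >= 0 for unit vectors x, y, z, so by Mantel's theorem for
   probability measures its edge density is at most 1/2. Both chords must pass
   within distance 1/2 of the origin, and they are independent, which gives the
   upper bound 1/4. Equality holds for the uniform measure on two antipodal
   points, for which both chords are the same diameter with probability 1/4. *)
Require Import Defs.
From HB Require Import structures.
From mathcomp Require Import all_boot all_order all_algebra.
From mathcomp Require Import all_classical all_reals all_analysis.
From mathcomp Require Import measurable_realfun.
From mathcomp Require Import ring lra.

Set Implicit Arguments.
Unset Strict Implicit.
Unset Printing Implicit Defensive.

Import Order.TTheory GRing.Theory Num.Theory.
Import numFieldNormedType.Exports.

Local Open Scope classical_set_scope.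
Local Open Scope ring_scope.

(** * Plane geometry of chord lines in coordinates *)

Definition dot (R : realType) (z w : R * R) : R := z.1 * w.1 + z.2 * w.2.

Definition cross (R : realType) (z w : R * R) : R := z.1 * w.2 - z.2 * w.1.

Lemma dot_circle_pt (R : realType) (x : borel_circle R) :
  dot (circle_pt x) (circle_pt x) = 1.
Proof.
have : euclid_norm (circle_pt x) = 1 by exact: (set_valP x).
rewrite /euclid_norm /dot => /(congr1 (fun u => u ^+ 2)).
by rewrite sqr_sqrtr ?addr_ge0 ?sqr_ge0// expr1n -!expr2.
Qed.

Lemma circle_pt_inj (R : realType) : injective (@circle_pt R).
Proof. by move=> x y; exact: val_inj. Qed.

(** For unit vectors $|x-y|^2 = 2(1 - x\cdot y)$. This turns distinctness of endpoints into a
    polynomial inequality, which is what measurability needs. *)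
Lemma dot_circle_pt_lt1 (R : realType) (x y : borel_circle R) :
  (x != y) = (dot (circle_pt x) (circle_pt y) < 1).
Proof.
have [<-|xy] := eqVneq x y; first by rewrite dot_circle_pt ltxx.
have := dot_circle_pt x; have := dot_circle_pt y; have := @circle_pt_inj R x y.
rewrite /dot; move: (circle_pt x) (circle_pt y) => [a b] [c d]/= inj hy hx.
have e : (a - c) ^+ 2 + (b - d) ^+ 2 = 2 * (1 - (a * c + b * d)) by lra.
have ac := sqr_ge0 (a - c); have bd := sqr_ge0 (b - d).
rewrite lt_neqAle; apply/esym/andP; split; last lra.
apply: contra xy => /eqP k1; have [ac0 bd0] : (a - c) ^+ 2 = 0 /\ (b - d) ^+ 2 = 0.
  by split; lra.
apply/eqP/inj; congr pair; apply/eqP; rewrite -subr_eq0 -sqrf_eq0; exact/eqP.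
Qed.

Lemma euclid_norm_lt (R : realType) (z : R * R) (r : R) : 0 < r ->
  (euclid_norm z < r) = (dot z z < r ^+ 2).
Proof.
move=> r0; rewrite /euclid_norm /dot -!expr2.
by rewrite -[in LHS](gtr0_norm r0) -sqrtr_sqr ltr_sqrt ?exprn_gt0.
Qed.

Lemma aff_chordE (R : realType) (x y : borel_circle R) (z : R * R) : x != y ->
  aff x y z <-> cross (circle_pt y - circle_pt x) (z - circle_pt x) = 0.
Proof.
move=> xy; rewrite /aff (negbTE xy).
have := @circle_pt_inj R x y.
rewrite /cross; move: (circle_pt x) (circle_pt y) => [a b] [c d]/= inj.
case: z => u v /=; split.
  by move=> [t _ [<- <-]] /=; rewrite /GRing.scale/=; ring.
(* The parameter is read off a nonzero coordinate of the direction vector; if both coordinates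
   vanished, the endpoints would coincide. *)
move=> h; have [ca|ca] := eqVneq (c - a) 0; last first.
  exists ((u - a) / (c - a)) => //; congr pair; rewrite /= /GRing.scale/=.
    by field.
  have -> : v = b + (d - b) * (u - a) / (c - a).
    by apply: (mulIf ca); rewrite mulrDl divfK//; lra.
  by field.
have db : d - b != 0.
  apply: contra xy => /eqP db; apply/eqP/inj; congr pair; lra.
exists ((v - b) / (d - b)) => //; congr pair; rewrite /= /GRing.scale/=.
  rewrite ca mulr0; apply/eqP; rewrite eq_sym -subr_eq0; apply/eqP.
  apply: (mulIf db); move: h; rewrite ca; lra.
by field.
Qed.

(** The point of the line nearest to the origin is the midpoint of the chord, of squared norm $(1 +
    x\cdot y)/2$. The tangent case fits the same formula, with value 1. *)
Lemma aff_near_origin (R : realType) (x y : borel_circle R) (z : R * R) :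
  aff x y z -> (1 + dot (circle_pt x) (circle_pt y)) / 2 <= dot z z.
Proof.
have [<-{y}|xy] := eqVneq x y.
  rewrite /aff eqxx /=; rewrite dot_circle_pt; have := dot_circle_pt x.
  rewrite /dot; move: (circle_pt x) z => [a b] [u v]/= h e.
  have au := sqr_ge0 (u - a); have bv := sqr_ge0 (v - b).
  lra.
move=> h; move: xy; rewrite dot_circle_pt_lt1.
have := h; rewrite /aff; case: ifP => [/eqP<-|_ [t _ <-]].
  by rewrite dot_circle_pt ltxx.
have := dot_circle_pt x; have := dot_circle_pt y.
rewrite /dot; move: (circle_pt x) (circle_pt y) => [a b] [c d]/= hy hx hlt.
rewrite /GRing.scale/=.
set k := a * c + b * d in hlt *.
rewrite [leRHS](_ : _ = (1 - t) ^+ 2 * (a * a + b * b)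
  + t ^+ 2 * (c * c + d * d) + 2 * t * (1 - t) * k); last by rewrite /k; ring.
rewrite hx hy.
(* The gap between the two sides is half of this product; it vanishes at the midpoint $t = 1/2$. *)
suff : 0 <= (1 - 2 * t) ^+ 2 * (1 - k) by lra.
by rewrite mulr_ge0 ?sqr_ge0 ?subr_ge0 ?ltW.
Qed.

Lemma euclid_norm_ge0 (R : realType) (z : R * R) : 0 <= euclid_norm z.
Proof. exact: sqrtr_ge0. Qed.

Lemma dist_origin_lt (R : realType) (L : set (R * R)) (r : R) : L !=set0 ->
  (dist_origin L < r) <-> exists2 z, L z & euclid_norm z < r.
Proof.
move=> [z0 Lz0]; split.
  move=> /inf_lt [|_ [z Lz <-] zr]; last by exists z.
  by exists (euclid_norm z0), z0.
move=> [z Lz zr]; apply: le_lt_trans zr; apply: ge_inf; last by exists z.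
by exists 0 => _ [w _ <-]; exact: euclid_norm_ge0.
Qed.

(** Each coordinate of [v] times [cross a b] is a linear combination of [cross v a] and [cross v b],
    and some coordinate of [v] is nonzero. *)
Lemma cross_parallel (R : realType) (v a b : R * R) : v != 0 ->
  cross v a = 0 -> cross v b = 0 -> cross a b = 0.
Proof.
rewrite /cross; case: v a b => [v1 v2] [a1 a2] [b1 b2]/= v0 va vb.
have e1 : v1 * (a1 * b2 - a2 * b1) =
    a1 * (v1 * b2 - v2 * b1) - b1 * (v1 * a2 - v2 * a1).
  by ring.
have e2 : v2 * (a1 * b2 - a2 * b1) =
    a2 * (v1 * b2 - v2 * b1) - b2 * (v1 * a2 - v2 * a1).
  by ring.
move: e1 e2; rewrite va vb !mulr0 subrr => /eqP + /eqP; rewrite !mulf_eq0.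
case/orP => [/eqP v10|/eqP//]; case/orP => [/eqP v20|/eqP//].
by rewrite v10 v20 eqxx in v0.
Qed.

Lemma crossC (R : realType) (v w : R * R) : cross v w = - cross w v.
Proof. by rewrite /cross; ring. Qed.

Lemma crossDr (R : realType) (u v w : R * R) :
  cross u (v + w) = cross u v + cross u w.
Proof. by rewrite /cross/=; ring. Qed.

Lemma circle_pt_subr_neq0 (R : realType) (x y : borel_circle R) : x != y ->
  circle_pt y - circle_pt x != 0.
Proof. by apply: contra; rewrite subr_eq0 => /eqP/circle_pt_inj ->. Qed.

Lemma get_set1 (T : pointedType) (x : T) : get [set x] = x.
Proof. by apply: get_unique => // y. Qed.

(** * When two chord lines meet within distance [r] of the origin *)

Section chords.
Variables (R : realType) (x1 x2 x3 x4 : borel_circle R).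
Let p1 := circle_pt x1.
Let p2 := circle_pt x2.
Let p3 := circle_pt x3.
Let p4 := circle_pt x4.

Definition chord_det := cross (p2 - p1) (p4 - p3).
(** Cramer numerator of the parameter of the common point along the first chord. For [x3 != x4] it
    vanishes exactly when [x1] lies on the second line. *)
Definition chord_offset := cross (p3 - p1) (p4 - p3).
(* By Cramer's rule the common point of two non-parallel chord lines is
   [meet_num / chord_det]. *)
Definition meet_num : R * R := chord_det *: p1 + chord_offset *: (p2 - p1).

(** Each coordinate of the difference is a linear combination of the two line equations. The
    division-free form covers parallel lines too, and yields uniqueness of the common point when
    [chord_det] is nonzero. *)
Lemma meet_numE z : x1 != x2 -> x3 != x4 ->
  aff x1 x2 z -> aff x3 x4 z -> meet_num = chord_det *: z.
Proof.
move=> x12 x34 /(aff_chordE _ x12) + /(aff_chordE _ x34).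
rewrite -/p1 -/p2 -/p3 -/p4 /meet_num /chord_det /chord_offset /cross.
move: p1 p2 p3 p4 z => [a1 b1] [a2 b2] [a3 b3] [a4 b4] [u v]/= h12 h34.
congr pair; rewrite /= /GRing.scale/=; apply: subr0_eq.
  set e12 := (X in X = 0) in h12; set e34 := (X in X = 0) in h34.
  transitivity (e34 * (a2 - a1) - e12 * (a4 - a3)); last by rewrite h12 h34; ring.
  by rewrite /e12 /e34; ring.
set e12 := (X in X = 0) in h12; set e34 := (X in X = 0) in h34.
transitivity (e34 * (b2 - b1) - e12 * (b4 - b3)); last by rewrite h12 h34; ring.
by rewrite /e12 /e34; ring.
Qed.

Lemma meet_num_aff : x1 != x2 -> x3 != x4 -> chord_det != 0 ->
  let z := chord_det^-1 *: meet_num in aff x1 x2 z /\ aff x3 x4 z.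
Proof.
move=> x12 x34 D0 z; split; apply/aff_chordE => //; move: D0; rewrite {}/z;
rewrite -/p1 -/p2 -/p3 -/p4 /meet_num /chord_offset.
  set D := chord_det; move: D; rewrite /cross.
  move: p1 p2 p3 p4 => [a1 b1] [a2 b2] [a3 b3] [a4 b4]/= D D0.
  by rewrite /GRing.scale/=; field.
rewrite /chord_det /cross.
move: p1 p2 p3 p4 => [a1 b1] [a2 b2] [a3 b3] [a4 b4]/= D0.
by rewrite /GRing.scale/=; field.
Qed.

(** Both [z - p1] and [p4 - p3] are parallel to [p2 - p1], hence to each other; moreover [z - p3] is
    parallel to [p4 - p3]. *)
Lemma aff_meet_parallel z : x1 != x2 -> x3 != x4 ->
  aff x1 x2 z -> aff x3 x4 z -> chord_det = 0 -> chord_offset = 0.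
Proof.
move=> x12 x34 /(aff_chordE _ x12) h12 /(aff_chordE _ x34) h34 D0.
have := cross_parallel (circle_pt_subr_neq0 x12) h12 D0.
rewrite /chord_offset (_ : cross (p3 - p1) _ =
  cross (z - p1) (p4 - p3) + cross (p4 - p3) (z - p3)).
  by rewrite h34 addr0.
by rewrite /cross/=; ring.
Qed.

Lemma aff_same : x1 != x2 -> x3 != x4 -> chord_det = 0 -> chord_offset = 0 ->
  aff x1 x2 = aff x3 x4.
Proof.
move=> x12 x34 D0 N0.
have p2p1 := circle_pt_subr_neq0 x12; have p4p3 := circle_pt_subr_neq0 x34.
have D0' : cross (p4 - p3) (p2 - p1) = 0 by rewrite crossC -/chord_det D0 oppr0.
have N0' : cross (p4 - p3) (p3 - p1) = 0 by rewrite crossC -/chord_offset N0 oppr0.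
have zE z : z - p1 = (z - p3) + (p3 - p1) by rewrite addrA subrK.
apply/seteqP; split=> z => [/(aff_chordE _ x12)|/(aff_chordE _ x34)] h.
  apply/(aff_chordE _ x34).
  have : cross (p4 - p3) (z - p1) = 0 by apply: cross_parallel D0 h.
  by rewrite zE (crossDr _ (z - p3)) N0' addr0.
apply/(aff_chordE _ x12); apply: cross_parallel p4p3 D0' _.
by rewrite -/p1 zE crossDr N0' addr0.
Qed.

Lemma midpoint_aff : x1 != x2 ->
  let z := 2^-1 *: (p1 + p2) in
  aff x1 x2 z /\ dot z z = (1 + dot p1 p2) / 2.
Proof.
move=> x12 z; split.
  apply/aff_chordE => //; rewrite {}/z -/p1 -/p2 /cross.
  move: p1 p2 => [a1 b1] [a2 b2]/=.
  by rewrite /GRing.scale/=; field.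
have := dot_circle_pt x1; have := dot_circle_pt x2; rewrite {}/z -/p1 -/p2 /dot.
by move: p1 p2 => [a1 b1] [a2 b2]/=; rewrite /GRing.scale/=; lra.
Qed.

Lemma circle_pt_aff : aff x1 x2 p1.
Proof.
rewrite /aff -/p1 -/p2; case: ifP => _; first by rewrite /= !subrr !mul0r addr0.
by exists 0 => //; rewrite scale0r addr0.
Qed.

(** A common treatment of the finite cases of [meet_dist]: a single common point serves itself, and
    for equal lines an infimum below [r] leaves a point of norm below [r]. *)
Lemma meet_dist_lt_point (r : R) : 0 < r ->
  (meet_dist x1 x2 x3 x4 < r%:E)%E ->
  exists z, [/\ aff x1 x2 z, aff x3 x4 z & dot z z < r ^+ 2].
Proof.
move=> r0; rewrite /meet_dist; case: ifP => [/asboolP[z hz]|_].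
  rewrite hz get_set1 lte_fin (euclid_norm_lt _ r0) => zr.
  by have [? ?] : (aff x1 x2 `&` aff x3 x4) z by [rewrite hz]; exists z.
case: ifP => // /asboolP<-.
rewrite lte_fin dist_origin_lt; last by exists p1; exact: circle_pt_aff.
by move=> [z hz]; rewrite euclid_norm_lt// => zr; exists z.
Qed.

(** Removes [get] and [inf] in favour of polynomial conditions on the coordinates. It serves both to
    prove the event measurable and to evaluate it on antipodal points. *)
Lemma meet_dist_ltE (r : R) : 0 < r -> r <= 1 ->
  (meet_dist x1 x2 x3 x4 < r%:E)%E <->
  [/\ x1 != x2, x3 != x4 &
    dot meet_num meet_num < r ^+ 2 * chord_det ^+ 2 \/
    [/\ chord_det = 0, chord_offset = 0 & (1 + dot p1 p2) / 2 < r ^+ 2]].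
Proof.
move=> r0 r1; split.
  move=> lt_r.
  have [z [h12 h34 zr]] := meet_dist_lt_point r0 lt_r.
  have r21 : r ^+ 2 <= 1 by rewrite exprn_ile1// ltW.
  (* A tangent line stays at distance 1 from the origin, so equal endpoints would contradict
     [r <= 1]. *)
  have x12 : x1 != x2.
    have := aff_near_origin h12; rewrite dot_circle_pt_lt1.
    have := dot_circle_pt x1; lra.
  have x34 : x3 != x4.
    have := aff_near_origin h34; rewrite dot_circle_pt_lt1.
    have := dot_circle_pt x3; lra.
  split => //; have [D0|D0] := eqVneq chord_det 0.
    right; split => //; first exact: aff_meet_parallel h12 h34 D0.
    exact: le_lt_trans (aff_near_origin h12) zr.
  left; rewrite (meet_numE x12 x34 h12 h34).
  rewrite (_ : dot _ _ = dot z z * chord_det ^+ 2); last first.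
    by rewrite /dot /= /GRing.scale/=; ring.
  by rewrite ltr_pM2r// exprn_even_gt0.
move=> [x12 x34 [lt_r|[D0 N0 lt_r]]]; rewrite /meet_dist.
  have D0 : chord_det != 0.
    apply: contraTneq lt_r => ->; rewrite expr0n mulr0 -leNgt.
    by rewrite /dot -!expr2 addr_ge0 ?sqr_ge0.
  have [z12 z34] := meet_num_aff x12 x34 D0.
  have hz : aff x1 x2 `&` aff x3 x4 = [set chord_det^-1 *: meet_num].
    apply/seteqP; split=> [z [h12 h34]|z ->//].
    by rewrite /= (meet_numE x12 x34 h12 h34) scalerA mulVf// scale1r.
  rewrite ifT; last by apply/asboolP; eexists; exact: hz.
  rewrite hz get_set1 lte_fin (euclid_norm_lt _ r0).
  rewrite (_ : dot _ _ = dot meet_num meet_num / chord_det ^+ 2).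
    by rewrite ltr_pdivrMr// exprn_even_gt0.
  by rewrite /dot /= /GRing.scale/=; field.
(* The lines coincide, and their intersection is no singleton because it contains the distinct
   points [p1] and [p2]. *)
rewrite -(aff_same x12 x34 D0 N0) setIid ifF; last first.
  apply/asboolP => -[z hz].
  have h1 : [set z] p1 by rewrite -hz; exact: circle_pt_aff.
  have h2 : [set z] p2.
    by rewrite -hz; apply/aff_chordE => //; rewrite /cross; ring.
  by move/eqP: x12; apply; apply: circle_pt_inj; rewrite -/p1 h1 -h2.
rewrite ifT ?lte_fin; last exact/asboolP.
apply/dist_origin_lt; first by exists p1; exact: circle_pt_aff.
have [h12 e] := midpoint_aff x12.
by eexists; [exact: h12|rewrite euclid_norm_lt// e].
Qed.

End chords.

(** * Borel measurability of the coordinates on the circle *)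

Lemma measurable_circle_comp (R : realType) (f : R * R -> R) : continuous f ->
  measurable_fun [set: borel_circle R] (f \o @circle_pt R).
Proof.
move=> cf; apply: (measurability _ (RGenOpens.measurableE R)) => _ [_ [a [b ->]] <-].
rewrite setTI; apply: sub_sigma_algebra.
rewrite comp_preimage.
have o : open (f @^-1` `]a, b[%classic).
  by apply: open_comp; [move=> x _; exact: cf|exact: interval_open].
(* Open sets of the subspace topology are the traces of open sets of the plane. *)
by exists (f @^-1` `]a, b[%classic).
Qed.

Lemma measurable_circle_pt1 (R : realType) :
  measurable_fun [set: borel_circle R] (fun x => (circle_pt x).1).
Proof. by apply: (@measurable_circle_comp _ fst) => x; exact: cvg_fst. Qed.

Lemma measurable_circle_pt2 (R : realType) :
  measurable_fun [set: borel_circle R] (fun x => (circle_pt x).2).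
Proof. by apply: (@measurable_circle_comp _ snd) => x; exact: cvg_snd. Qed.

(** * Independence of the two pairs, and Mantel's theorem for probability measures *)

Section product_measures.
Local Open Scope ereal_scope.

(** The product is nested to the left, so the last two factors are not grouped as a pair; Tonelli's
    theorem for [m1 \x m2] regroups them. In the application [T1] is itself a space of pairs. *)
Lemma product_measure_pairs d1 d2 d3 (T1 : measurableType d1)
    (T2 : measurableType d2) (T3 : measurableType d3) (R : realType)
    (m1 : {sigma_finite_measure set T1 -> \bar R})
    (m2 : {sigma_finite_measure set T2 -> \bar R})
    (m3 : {sigma_finite_measure set T3 -> \bar R})
    (E : set T1) (F : set (T2 * T3)) : measurable E -> measurable F ->
  (m1 \x m2 \x m3) [set x | E x.1.1 /\ F (x.1.2, x.2)] = m1 E * (m2 \x m3) F.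
Proof.
move=> mE mF; rewrite [LHS]/product_measure1.
have mxF : measurable_fun setT (fun y => m3 (xsection F y) : \bar R).
  exact: measurable_fun_xsection.
(* The section over [w] is the section of [F] over [w.2] when [w.1] lies in [E], and is empty
   otherwise. *)
transitivity (\int[m1 \x m2]_w ((\1_E w.1)%:E * m3 (xsection F w.2))).
  apply: eq_integral => w _ /=; rewrite indicE; have [|] := boolP (w.1 \in E).
    rewrite inE => Ew; rewrite mul1e; congr (m3 _).
    by apply/seteqP; split=> y; rewrite /xsection/= !inE/=; tauto.
  rewrite notin_setE => Ew; rewrite mul0e (_ : xsection _ _ = set0) ?measure0//.
  by rewrite -subset0 => y; rewrite /xsection/= inE/= => -[].
rewrite fubini_tonelli1/=; last 2 first.
- apply: emeasurable_funM.
    by apply/measurable_EFinP; apply: (measurableT_comp (measurable_indic mE)).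
  exact: (measurableT_comp mxF).
- by move=> w; rewrite mule_ge0 ?lee_fin.
rewrite /fubini_F/=.
under eq_integral => x _ do rewrite ge0_integralZl//.
rewrite ge0_integralZr//; last 2 first.
- by apply/measurable_EFinP; exact: measurable_indic.
- by apply: integral_ge0.
by rewrite integral_indic// setIT.
Qed.

Lemma product_probability_pairs d (T : measurableType d) (R : realType)
    (P : probability T R) (E F : set (T * T)) : measurable E -> measurable F ->
  (P \x P \x P \x P) [set x | E x.1.1 /\ F (x.1.2, x.2)] =
  (P \x P) E * (P \x P) F.
Proof.
move=> mE mF.
(* [product_subprobability] packs [P \x P] as a measure. *)
pose Q : subprobability T R := P.
exact: (@product_measure_pairs _ _ _ _ _ _ _ (product_subprobability (Q, Q))
  P P E F mE mF).
Qed.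

(* Mantel's theorem: adjacent x and y have disjoint neighbourhoods, so
   deg x + deg y <= 1 on E. Integrating this over E bounds twice the integral of
   deg^2 by the integral of deg, and deg <= deg^2 + 1/4. *)
Lemma triangle_free_le d (T : measurableType d) (R : realType)
    (P : probability T R) (E : set (T * T)) : measurable E ->
  (forall x y, E (x, y) -> E (y, x)) ->
  (forall x y z, E (x, y) -> E (y, z) -> ~ E (x, z)) ->
  (P \x P) E <= (1 / 2)%:E.
Proof.
move=> mE symE freeE.
pose deg x := P (xsection E x).
have mdeg : measurable_fun setT (deg : T -> \bar R) by exact: measurable_fun_xsection.
have deg0 x : 0 <= deg x by exact: measure_ge0.
have PE : (P \x P) E = \int[P]_x deg x by [].
have PE1 : (P \x P) E <= 1 by exact: probability_le1.
have deg_fin x : deg x = (fine (deg x))%:E.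
  rewrite fineK// ge0_fin_numE//; apply: le_lt_trans (ltry 1).
  by apply: probability_le1; exact: measurable_xsection.
have mdeg2 : measurable_fun setT (fun x => deg x * deg x) by exact: emeasurable_funM.
have deg_le : \int[P]_x deg x <= \int[P]_x (deg x * deg x) + (1 / 4)%:E.
  rewrite -[X in _ + X]mule1 -(probability_setT P) -integral_cst//.
  rewrite -ge0_integralD//; last 2 first.
  - by move=> x _; exact: mule_ge0.
  - by move=> x _; rewrite lee_fin.
  apply: ge0_le_integral => //.
  - by apply: emeasurable_funD => //; exact: measurable_cst.
  move=> x _; rewrite deg_fin -EFinM -EFinD lee_fin.
  by have := sqr_ge0 (fine (deg x) - 1 / 2); lra.
have mind : measurable_fun setT (fun z => (\1_E z)%:E : \bar R).
  by apply/measurable_EFinP; exact: measurable_indic.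
have m1 : measurable_fun setT (fun z => deg z.1 * (\1_E z)%:E).
  by apply: emeasurable_funM => //; exact: (measurableT_comp mdeg).
have m2 : measurable_fun setT (fun z => deg z.2 * (\1_E z)%:E).
  by apply: emeasurable_funM => //; exact: (measurableT_comp mdeg).
(* With the first variable fixed at [x], integrating the indicator of [E] over the second gives a
   further factor [deg x]. For [sum2] the roles are exchanged, using the symmetry of [E]. *)
have sum1 : \int[P \x P]_z (deg z.1 * (\1_E z)%:E) = \int[P]_x (deg x * deg x).
  rewrite fubini_tonelli1//=; last by move=> z; rewrite mule_ge0// lee_fin.
  rewrite /fubini_F/=; apply: eq_integral => x _.
  rewrite ge0_integralZl//; last exact: measurable_fun_pair2 x mind.
  by congr (_ * _); exact: (congr1 (fun f => f x) (indic_fubini_tonelli_FE P mE)).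
have ysecE y : ysection E y = xsection E y.
  by apply/seteqP; split=> x; rewrite /xsection /ysection/= !inE; exact: symE.
have sum2 : \int[P \x P]_z (deg z.2 * (\1_E z)%:E) = \int[P]_x (deg x * deg x).
  rewrite fubini_tonelli2//=; last by move=> z; rewrite mule_ge0// lee_fin.
  rewrite /fubini_G/=; apply: eq_integral => y _.
  rewrite ge0_integralZl//; last exact: measurable_fun_pair1 y mind.
  rewrite {3}/deg -ysecE.
  by congr (_ * _); exact: (congr1 (fun f => f y) (indic_fubini_tonelli_GE P mE)).
have degD : \int[P]_x (deg x * deg x) + \int[P]_x (deg x * deg x) <= (P \x P) E.
  rewrite -[X in X + _]sum1 -sum2 -ge0_integralD//; last 2 first.
  - by move=> z _; rewrite mule_ge0// lee_fin.
  - by move=> z _; rewrite mule_ge0// lee_fin.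
  have -> : (P \x P) E = \int[P \x P]_z (\1_E z)%:E by rewrite integral_indic// setIT.
  apply: ge0_le_integral => //.
  - by move=> z _; rewrite adde_ge0// mule_ge0// lee_fin.
  - exact: emeasurable_funD.
  move=> [x y] _ /=; rewrite indicE; have [|_] := boolP (_ \in E); last first.
    by rewrite !mule0 adde0.
  rewrite inE => Exy; rewrite !mule1 /deg -measureU; first last.
  - apply/seteqP; split=> // z [].
    rewrite /xsection/= !inE => Exz Eyz; exact: (freeE _ _ _ Exy Eyz).
  - exact: measurable_xsection.
  - exact: measurable_xsection.
  by apply: probability_le1; apply: measurableU; exact: measurable_xsection.
have PEfin : (P \x P) E = (fine ((P \x P) E))%:E.
  by rewrite fineK// ge0_fin_numE ?measure_ge0//; exact: le_lt_trans (ltry 1).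
have S0 : 0 <= \int[P]_x (deg x * deg x).
  by apply: integral_ge0 => x _; exact: mule_ge0.
move: deg_le degD; rewrite -PE PEfin.
(* Nonnegativity excludes [-oo] and [degD] excludes [+oo]. With $m$ the measure of [E], what remains
   is $m \le s + 1/4$ and $2s \le m$, whence $m \le 1/2$. *)
move: (\int[P]_x (deg x * deg x)) S0 => [s|//|//] _.
by rewrite -!EFinD !lee_fin; lra.
Qed.

End product_measures.

(** * Measurability of the event that the lines meet within distance [r] *)

Section measurable_vec.
Context d (T : measurableType d) (R : realType).

Definition measurable_vec (u : T -> R * R) :=
  measurable_fun setT (fun t => (u t).1) /\
  measurable_fun setT (fun t => (u t).2).

Lemma measurable_vec_circle (x : T -> borel_circle R) :
  measurable_fun setT x -> measurable_vec (@circle_pt R \o x).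
Proof.
by move=> mx; split;
  [exact: (measurableT_comp (@measurable_circle_pt1 R))
  |exact: (measurableT_comp (@measurable_circle_pt2 R))].
Qed.

Lemma measurable_vecB u v : measurable_vec u -> measurable_vec v ->
  measurable_vec (fun t => u t - v t).
Proof. by move=> [u1 u2] [v1 v2]; split; exact: measurable_funB. Qed.

Lemma measurable_vecD u v : measurable_vec u -> measurable_vec v ->
  measurable_vec (fun t => u t + v t).
Proof. by move=> [u1 u2] [v1 v2]; split; exact: measurable_funD. Qed.

Lemma measurable_vecZ (f : T -> R) u : measurable_fun setT f -> measurable_vec u ->
  measurable_vec (fun t => f t *: u t).
Proof. by move=> mf [u1 u2]; split; exact: measurable_funM. Qed.

Lemma measurable_dot u v : measurable_vec u -> measurable_vec v ->
  measurable_fun setT (fun t => dot (u t) (v t)).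
Proof.
by move=> [u1 u2] [v1 v2]; apply: measurable_funD; exact: measurable_funM.
Qed.

Lemma measurable_cross u v : measurable_vec u -> measurable_vec v ->
  measurable_fun setT (fun t => cross (u t) (v t)).
Proof.
by move=> [u1 u2] [v1 v2]; apply: measurable_funB; exact: measurable_funM.
Qed.

Lemma measurable_setlt (f g : T -> R) : measurable_fun setT f ->
  measurable_fun setT g -> measurable [set t | f t < g t].
Proof.
move=> mf mg; rewrite -[X in measurable X]setTI.
under eq_set => t do rewrite -lte_fin.
by apply: measurable_lte => //; exact/measurable_EFinP.
Qed.

Lemma measurable_seteq (f g : T -> R) : measurable_fun setT f ->
  measurable_fun setT g -> measurable [set t | f t = g t].
Proof.
move=> mf mg.
rewrite (_ : [set t | _] = setT `&` [set t | (f t)%:E = (g t)%:E]).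
  by apply: measurable_eqe => //; exact/measurable_EFinP.
by rewrite setTI; apply/seteqP; split=> t /= => [->|[]].
Qed.

(** By [meet_dist_ltE] the event is a finite combination of polynomial equations and strict
    inequalities in the coordinates. *)
Lemma measurable_meet_dist_lt (x1 x2 x3 x4 : T -> borel_circle R) (r : R) :
  0 < r -> r <= 1 ->
  measurable_fun setT x1 -> measurable_fun setT x2 ->
  measurable_fun setT x3 -> measurable_fun setT x4 ->
  measurable [set t | (meet_dist (x1 t) (x2 t) (x3 t) (x4 t) < r%:E)%E].
Proof.
move=> r0 r1 /measurable_vec_circle m1 /measurable_vec_circle m2.
move=> /measurable_vec_circle m3 /measurable_vec_circle m4.
have mdet : measurable_fun setT (fun t => chord_det (x1 t) (x2 t) (x3 t) (x4 t)).
  by apply: measurable_cross; exact: measurable_vecB.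
have moff : measurable_fun setT (fun t => chord_offset (x1 t) (x3 t) (x4 t)).
  by apply: measurable_cross; exact: measurable_vecB.
have mnum : measurable_vec (fun t => meet_num (x1 t) (x2 t) (x3 t) (x4 t)).
  apply: measurable_vecD; apply: measurable_vecZ => //.
  exact: measurable_vecB.
pose p1 := @circle_pt R \o x1; pose p2 := @circle_pt R \o x2.
pose p3 := @circle_pt R \o x3; pose p4 := @circle_pt R \o x4.
rewrite (_ : [set t | _] =
  [set t | dot (p1 t) (p2 t) < 1] `&` [set t | dot (p3 t) (p4 t) < 1] `&`
  ([set t | dot (meet_num (x1 t) (x2 t) (x3 t) (x4 t))
                (meet_num (x1 t) (x2 t) (x3 t) (x4 t)) <
            r ^+ 2 * chord_det (x1 t) (x2 t) (x3 t) (x4 t) ^+ 2] `|`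
   [set t | chord_det (x1 t) (x2 t) (x3 t) (x4 t) = 0] `&`
   [set t | chord_offset (x1 t) (x3 t) (x4 t) = 0] `&`
   [set t | (1 + dot (p1 t) (p2 t)) / 2 < r ^+ 2])).
  apply: measurableI.
    by apply: measurableI; apply: measurable_setlt => //; exact: measurable_dot.
  apply: measurableU.
    apply: measurable_setlt; first exact: measurable_dot.
    by apply: measurable_funM => //; exact: measurable_funX.
  apply: measurableI.
    by apply: measurableI; exact: measurable_seteq.
  apply: measurable_setlt => //; apply: measurable_funM => //.
  by apply: measurable_funD => //; exact: measurable_dot.
apply/seteqP; split=> t /=; rewrite meet_dist_ltE// !dot_circle_pt_lt1.
  by move=> [? ? [?|[? ? ?]]]; split=> //; [left|right].
by move=> [[? ?] [?|[[? ?] ?]]]; split=> //; [left|right].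
Qed.

End measurable_vec.

(** * The triangle-free graph of chords close to the origin *)

Section far_pairs.
Variable R : realType.

(* The endpoints are more than 120 degrees apart, i.e. their chord comes closer
   than 1/2 to the origin. *)
Definition far_pairs : set (borel_circle R * borel_circle R) :=
  [set x | dot (circle_pt x.1) (circle_pt x.2) < - (1 / 2)].

Lemma measurable_far_pairs : measurable far_pairs.
Proof.
apply: measurable_setlt => //; apply: measurable_dot.
  exact: (measurable_vec_circle measurable_fst).
exact: (measurable_vec_circle measurable_snd).
Qed.

Lemma far_pairs_sym x y : far_pairs (x, y) -> far_pairs (y, x).
Proof. by rewrite /far_pairs/= /dot; lra. Qed.

Lemma far_pairs_triangle_free x y z :
  far_pairs (x, y) -> far_pairs (y, z) -> ~ far_pairs (x, z).
Proof.
rewrite /far_pairs/=.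
have := dot_circle_pt x; have := dot_circle_pt y; have := dot_circle_pt z.
rewrite /dot.
move: (circle_pt x) (circle_pt y) (circle_pt z) => [a b] [c d] [e f]/= *.
by have := sqr_ge0 (a + c + e); have := sqr_ge0 (b + d + f); lra.
Qed.

(** From $(1 + x\cdot y)/2 \le |z|^2 < 1/4$ one gets $x\cdot y < -1/2$; this is where the radius
    $1/2$ matches the triangle-free threshold. *)
Lemma aff_far_pairs (x y : borel_circle R) z :
  aff x y z -> dot z z < (1 / 2) ^+ 2 -> far_pairs (x, y).
Proof. by move=> /aff_near_origin; rewrite /far_pairs/=; lra. Qed.

End far_pairs.

(** * Upper and lower bounds for a given measure *)

Section bounds.
Variables (R : realType) (r : R).
Hypotheses (r0 : 0 < r) (r12 : r <= 1 / 2).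

Let r1 : r <= 1. Proof. by move: r12; lra. Qed.

Let quads (E : set (borel_circle R * borel_circle R)) :=
  [set x : borel_circle R * borel_circle R * borel_circle R * borel_circle R |
    E x.1.1 /\ E (x.1.2, x.2)].

Lemma measurable_quads E : measurable E -> measurable (quads E).
Proof.
move=> mE; apply: measurableI; rewrite -[X in measurable X]setTI.
  exact: (measurableT_comp measurable_fst measurable_fst).
apply: (measurable_fun_pair (measurableT_comp measurable_snd measurable_fst)
  measurable_snd) => //.
Qed.

Let measurable_quad_lt : measurable
  [set x : borel_circle R * borel_circle R * borel_circle R * borel_circle R
    | (meet_dist x.1.1.1 x.1.1.2 x.1.2 x.2 < r%:E)%E].
Proof.
by apply: measurable_meet_dist_lt => //;
  do ?[apply: (measurableT_comp measurable_fst)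
      |apply: (measurableT_comp measurable_snd)].
Qed.

Variable mu : probability (borel_circle R) R.

Lemma prob_lt_le : (prob_lt mu r <= (1 / 4)%:E)%E.
Proof.
apply: (@le_trans _ _ ((mu \x mu \x mu \x mu)%E (quads (@far_pairs R)))).
  apply: le_measure; rewrite ?inE.
  - exact: measurable_quad_lt.
  - by apply: measurable_quads; exact: measurable_far_pairs.
  have r2 : r ^+ 2 <= (1 / 2) ^+ 2.
    by rewrite lerXn2r ?nnegrE ?(ltW r0)//; move: r12; lra.
  move=> x /= /(meet_dist_lt_point r0)[z [h12 h34 zr]].
  by split; [apply: aff_far_pairs h12 _|apply: aff_far_pairs h34 _];
    exact: lt_le_trans zr r2.
have mfar := @measurable_far_pairs R.
rewrite (product_probability_pairs mu mfar mfar).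
have := triangle_free_le mu mfar (@far_pairs_sym R) (@far_pairs_triangle_free R).
have -> : ((1 / 4)%:E = (1 / 2)%:E * (1 / 2)%:E :> \bar R)%E.
  by rewrite -EFinM; congr EFin; field.
by move=> h; apply: lee_pmul.
Qed.

(** If any two chords from [E] meet within distance [r], it suffices that both random pairs fall in
    [E]; their independence gives the square. *)
Lemma prob_lt_ge (E : set (borel_circle R * borel_circle R)) : measurable E ->
  (forall x1 x2 x3 x4, E (x1, x2) -> E (x3, x4) ->
    (meet_dist x1 x2 x3 x4 < r%:E)%E) ->
  ((mu \x mu) E * (mu \x mu) E <= prob_lt mu r)%E.
Proof.
move=> mE h; rewrite -(product_probability_pairs mu mE mE).
apply: le_measure; rewrite ?inE.
- exact: measurable_quads.
- exact: measurable_quad_lt.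
by move=> [[[x1 x2] x3] x4] [/= E12 E34]; exact: h.
Qed.

End bounds.

(** * The extremal measure on two antipodal points *)

Section antipodal.
Variable R : realType.

Lemma unit_circle_antipode : ((-1, 0) : R * R) \in @unit_circle R.
Proof.
apply/mem_set; rewrite /unit_circle /euclid_norm /=.
by rewrite sqrrN expr1n expr0n addr0 sqrtr1.
Qed.

(** Indexing by [bool] makes the extremal measure the law of a fair coin; measurability is automatic
    since all subsets of [bool] are measurable. *)
Definition antipodal (b : bool) : borel_circle R :=
  if b then SigSub (unit_circle_point R) else SigSub unit_circle_antipode.

Lemma antipodalE b : circle_pt (antipodal b) = (if b then 1 else -1, 0).
Proof. by case: b. Qed.

Let measurable_antipodal : measurable_fun setT antipodal.
Proof. by []. Qed.

HB.instance Definition _ :=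
  isMeasurableFun.Build _ _ _ _ antipodal measurable_antipodal.

Definition antipodal_prob : probability (borel_circle R) R :=
  distribution (bernoulli_prob (1 / 2 : R)) antipodal.

(** Prescribing only the first coordinate makes measurability immediate; on the unit circle the
    value 1 or -1 forces the second coordinate to be 0. *)
Let atom (b : bool) : set (borel_circle R) :=
  [set x | (circle_pt x).1 = if b then 1 else -1].

Let measurable_atom b : measurable (atom b).
Proof.
apply: measurable_seteq; first exact: measurable_circle_pt1.
exact: measurable_cst.
Qed.

Let atomP b x : atom b x -> circle_pt x = (if b then 1 else -1, 0).
Proof.
rewrite /atom/=; have := dot_circle_pt x; rewrite /dot.
move: (circle_pt x) => [u v]/= + uE; rewrite {}uE => h; congr pair.
apply/eqP; rewrite -sqrf_eq0; apply/eqP; case: b h => h; nra.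
Qed.

Let antipodal_prob_atom b : antipodal_prob (atom b) = (1 / 2)%:E.
Proof.
have p01 : 0 <= (1 / 2 : R) <= 1 by lra.
rewrite [LHS](bernoulli_probE p01 (antipodal @^-1` atom b)) !diracE.
have atomE c : (c \in antipodal @^-1` atom b) = (c == b).
  apply/idP/eqP => [|->]; rewrite ?inE /atom/= antipodalE//=.
  by case: b c => -[]//=; lra.
rewrite !atomE /unstable.onem.
by case: b {atomE} => /=; rewrite ?mule1 ?mule0 ?adde0 ?add0e//; congr EFin; field.
Qed.

Lemma prob_lt_antipodal_ge r : 0 < r -> r <= 1 / 2 ->
  ((1 / 4)%:E <= prob_lt antipodal_prob r)%E.
Proof.
move=> r0 r12.
(* The pairs of opposite points: two disjoint rectangles of mass $1/4$ each, so [E] has mass $1/2$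
   and its square is the required $1/4$. *)
pose E := (atom true `*` atom false) `|` (atom false `*` atom true).
have mE : measurable E by apply: measurableU; exact: measurableX.
have rect b c : (antipodal_prob \x antipodal_prob)%E (atom b `*` atom c) =
    (1 / 2 * (1 / 2))%:E.
  rewrite product_measure1E// EFinM.
  by congr (_ * _)%E; exact: antipodal_prob_atom.
have PE : (antipodal_prob \x antipodal_prob)%E E = (1 / 2)%:E.
  rewrite measureU; [|exact: measurableX|exact: measurableX|].
    transitivity ((1 / 2 * (1 / 2))%:E + (1 / 2 * (1 / 2))%:E : \bar R)%E.
      by congr (_ + _)%E; exact: rect.
    by rewrite -EFinD; congr EFin; field.
  apply/seteqP; split=> // -[x y] [[/= xt _] [/= xf _]].
  by move: xt; rewrite /atom/= xf; lra.
have := prob_lt_ge r0 r12 antipodal_prob mE; rewrite PE -EFinM.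
rewrite (_ : 1 / 2 * (1 / 2) = 1 / 4 :> R); last by field.
have EP x1 x2 : E (x1, x2) -> exists b, circle_pt x1 = (if b then 1 else -1, 0) /\
    circle_pt x2 = (if b then -1 else 1, 0).
  by move=> [][/= /atomP-> /atomP->]; [exists true|exists false].
apply=> x1 x2 x3 x4 /EP[b [e1 e2]] /EP[c [e3 e4]].
apply/meet_dist_ltE => //; first by lra.
rewrite !dot_circle_pt_lt1 /chord_det /chord_offset /cross /dot e1 e2 e3 e4/=.
have r20 : 0 < r ^+ 2 by rewrite exprn_gt0.
(* All four points lie on the horizontal axis, so both cross products vanish; opposite endpoints
   have inner product $-1$, so the last condition reduces to $0 < r^2$. *)
by move: b c {e1 e2 e3 e4} => [] []; split; rewrite /=; try lra;
  right; split; lra.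
Qed.

End antipodal.

Theorem theorem1p5 (R : realType) (r : R) (hr0 : 0 < r) (hr : r <= 1 / 2) :
  sup_prob r = (1 / 4 : R)%:E.
Proof.
apply/eqP; rewrite eq_le; apply/andP; split.
  by apply: ge_ereal_sup => _ [mu _ <-]; exact: prob_lt_le.
apply: le_trans (prob_lt_antipodal_ge hr0 hr) _.
by apply: ereal_sup_ubound; exists (antipodal_prob R).
Qed.
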